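(* Let an instance with item set $E$, values $a_i$, sizes $d_i$ and capacities $0\le R<D$ be given. Let $X\subseteq E$ satisfy $d(X)\le D$, let $Z\subseteq E$ satisfy $d(Z)\le R$, and put $n=|X|$, $m=|Z|$. (a) If $x\in X$ is long (that is, $d_x>R$), then the set $(X\setminus\{x\})\cup(Z\setminus X)$ has total size at most $D$, has cardinality $n-1+m-|X\cap Z|$, and has value $G(X)-a_x+G(Z)-G(X\cap Z)$. (b) If $x,x'\in X$ are distinct items with $d_x+d_{x'}>R$ and $y\in X\setminus\{x,x'\}$ satisfies $y\notin Z$, then $\{y\}\cup Z$ has total size at most $D$, has cardinality $m+1$, and has value $a_y+G(Z)$.
   Context: An instance consists of a finite set $E$ of items with rational values $a_i\ge 0$, positive integer sizes $d_i$, and integer capacities $0\le R<D$, with $d_i\le D$ for every item. Write $G(S)=\sum_{i\in S}a_i$ and $d(S)=\sum_{i\in S}d_i$. An item is long if $d_i>R$ and short otherwise. A set $S$ is $D$-feasible if $d(S)\le D$ and $R$-feasible if $d(S)\le R$. *)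

(* Defs.v *)
From mathcomp Require Import all_boot all_order all_algebra.

Set Implicit Arguments.
Unset Strict Implicit.
Unset Printing Implicit Defensive.

Import Order.TTheory GRing.Theory Num.Theory.
Local Open Scope ring_scope.

(* Sizes and capacities are integers that are nonnegative by assumption, hence
   natural numbers; [capR] and [capD] are the capacities R < D. *)
Record instance := Instance {
  item :> finType;
  value : item -> rat;
  item_size : item -> nat;
  capR : nat;
  capD : nat;
  value_ge0 : forall i : item, 0 <= value i;
  item_size_gt0 : forall i : item, (0 < item_size i)%N;
  capR_lt_capD : (capR < capD)%N;
  item_size_le_capD : forall i : item, (item_size i <= capD)%N
}.

Arguments value {_} i.
Arguments item_size {_} i.

Definition total_value (I : instance) (S : {set I}) : rat :=
  \sum_(i in S) value i.

Definition total_size (I : instance) (S : {set I}) : nat :=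
  (\sum_(i in S) item_size i)%N.

Definition long (I : instance) (i : I) : bool := (capR I < item_size i)%N.

Definition D_feasible (I : instance) (S : {set I}) : bool :=
  (total_size S <= capD I)%N.

Definition R_feasible (I : instance) (S : {set I}) : bool :=
  (total_size S <= capR I)%N.

(* Main.v *)
Require Import Defs.
From mathcomp Require Import all_boot all_order all_algebra.

Set Implicit Arguments.
Unset Strict Implicit.
Unset Printing Implicit Defensive.

Import Order.TTheory GRing.Theory Num.Theory.
Local Open Scope ring_scope.

(** Both parts are exchange arguments. Dropping a long item [x] from a
    [D]-feasible set frees more than [R] units of capacity, while an
    [R]-feasible set, or any part of it, needs at most [R]; so the exchange
    stays within [D]. In part (b) it is the pair [x], [x'] that frees this
    room: [y] shares [X] with the pair, hence has size less than [D - R].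

    The cardinality and value formulas of part (a) are one fact,
    [sum_exchange], about the sum of an arbitrary weight over
    [(X :\ x) :|: (Z :\: X)]: cardinality is the sum of the constant weight 1
    in the integers. Those of part (b) only say that [y] is new to [Z]. *)

Lemma disjoint_setD1_setD (T : finType) (X Z : {set T}) (x : T) :
  [disjoint X :\ x & Z :\: X].
Proof.
apply: (disjointWl (subD1set X x)).
by rewrite disjoint_sym -setI_eq0 setIDAC setDIl setDv setI0.
Qed.

Lemma big_setU_disj (R : Type) (idx : R) (op : Monoid.com_law idx) (T : finType)
    (A B : {set T}) (F : T -> R) :
  [disjoint A & B] ->
  \big[op/idx]_(i in A :|: B) F i =
    op (\big[op/idx]_(i in A) F i) (\big[op/idx]_(i in B) F i).
Proof.
by move=> disAB; rewrite -bigU //; apply: eq_bigl => i; rewrite !inE.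
Qed.

(** The union is disjoint even when [x] lies in [Z], because the second part
    leaves out all of [X], at the cost of the weight of [X :&: Z]. With
    weights in a group, the same identity serves the rational values and, with weight 1, the integer cardinalities. *)
Lemma sum_exchange (V : zmodType) (T : finType) (f : T -> V)
    (X Z : {set T}) (x : T) :
  x \in X ->
  \sum_(i in (X :\ x) :|: (Z :\: X)) f i =
    \sum_(i in X) f i - f x + \sum_(i in Z) f i - \sum_(i in X :&: Z) f i.
Proof.
move=> xX; rewrite big_setU_disj /=; last exact: disjoint_setD1_setD.
rewrite (big_setD1 x xX) /= [f x + _]addrC addrK.
by rewrite (big_setID X (A := Z)) /= setIC [\sum_(i in X :&: Z) f i + _]addrC
  addrA addrK.
Qed.

Lemma natz_card (T : finType) (S : {set T}) : #|S|%:Z = \sum_(i in S) (1 : int).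
Proof. by rewrite sumr_const natz. Qed.

Lemma total_sizeS (I : instance) (S U : {set I}) :
  S \subset U -> (total_size S <= total_size U)%N.
Proof.
by move=> sSU; rewrite /total_size [leqRHS](big_setID S) /= (setIidPr sSU) leq_addr.
Qed.

(** The part of [Z] that comes in has size at most [R], less than the size of
    the item [x] that goes out. *)
Lemma long_exchange_size (I : instance) (X Z : {set I}) (x : I) :
  D_feasible X -> R_feasible Z -> x \in X -> long x ->
  D_feasible ((X :\ x) :|: (Z :\: X)).
Proof.
rewrite /D_feasible /R_feasible /long => hX hZ xX xlong.
have hZX := leq_trans (total_sizeS (subsetDl Z X)) hZ.
rewrite /total_size big_setU_disj /=; last exact: disjoint_setD1_setD.
apply: leq_trans hX; rewrite /total_size [leqRHS](big_setD1 x xX) /= addnC leq_add2r.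
exact: leq_trans hZX (ltnW xlong).
Qed.

(** The set [y |: Z] arises from [X] by keeping only [y] of the items outside
    the pair and by replacing the pair, of total size above [R], with [Z]. *)
Lemma pair_exchange_size (I : instance) (X Z : {set I}) (x x' y : I) :
  D_feasible X -> R_feasible Z -> x \in X -> x' \in X -> x != x' ->
  (capR I < item_size x + item_size x')%N ->
  y \in X :\: [set x; x'] -> y \notin Z -> D_feasible (y |: Z).
Proof.
rewrite /D_feasible /R_feasible => hX hZ xX x'X neq_xx' hR yX yZ.
have spairX : [set x; x'] \subset X by rewrite subUset !sub1set xX.
rewrite /total_size big_setU1 //= addnC; apply: leq_trans hX.
rewrite /total_size [leqRHS](big_setID [set x; x']) /= (setIidPr spairX).
rewrite big_setU1 ?inE //= big_set1 (big_setD1 y yX) /= addnA.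
apply: leq_trans (leq_addr _ _); rewrite leq_add2r.
exact: leq_trans hZ (ltnW hR).
Qed.

Theorem lemma3p1 (I : instance) (X Z : {set I}) (n m : nat)
    (hX : D_feasible X) (hZ : R_feasible Z)
    (hn : n = #|X|) (hm : m = #|Z|) :
  (forall x : I, x \in X -> long x ->
     let A := (X :\ x) :|: (Z :\: X) in
     [/\ (total_size A <= capD I)%N,
         #|A|%:Z = n%:Z - 1 + m%:Z - #|X :&: Z|%:Z
       & total_value A =
           total_value X - value x + total_value Z - total_value (X :&: Z)]) /\
  (forall x x' y : I, x \in X -> x' \in X -> x != x' ->
     (capR I < item_size x + item_size x')%N ->
     y \in X :\: [set x; x'] -> y \notin Z ->
     let B := y |: Z in
     [/\ (total_size B <= capD I)%N,
         #|B| = m.+1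
       & total_value B = value y + total_value Z]).
Proof.
split=> [x xX xlong A | x x' y xX x'X neq_xx' hR yX yZ B].
  split; first exact: long_exchange_size.
  - by rewrite hn hm !natz_card sum_exchange.
  - exact: sum_exchange.
split; first exact: pair_exchange_size neq_xx' hR yX yZ.
- by rewrite cardsU1 yZ hm.
- exact: big_setU1.
Qed.
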